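(* Let $d$ and $r$ be integers with $1 \le r < \frac{d}{2}$, and let $\Delta$ be a $\mathbf{k}$-homology $(d-1)$-manifold without boundary. Then $\Delta$ is $(r-1)$-stacked if and only if it is locally $(r-1)$-stacked, i.e., for every vertex $v$ of $\Delta$ the link $\mathrm{lk}_\Delta(\{v\})$ is $(r-1)$-stacked.
   Context: $\mathbf{k}$ is a fixed infinite field. For a finite simplicial complex $\Gamma$, $\beta_i(\Gamma) = \dim_{\mathbf{k}} \tilde H_i(\Gamma;\mathbf{k})$, and for a face $F$, $\mathrm{lk}_\Gamma(F) = \{G \in \Gamma : F\cup G \in \Gamma,\ F \cap G = \emptyset\}$. A face $F$ has dimension $\#F-1$. A complex $\Gamma$ of dimension $m$ is a $\mathbf{k}$-homology $m$-sphere if for every face $F$ (including $\emptyset$), $\beta_i(\mathrm{lk}_\Gamma F)=0$ for $i \ne m-\#F$ and $\beta_{m-\#F}(\mathrm{lk}_\Gamma F)=1$. A homology $m$-manifold without boundary is a pure $m$-dimensional complex all of whose vertex links are homology $(m-1)$-spheres (homology spheres are themselves homology manifolds without boundary). A pure $m$-dimensional complex $\Gamma$ is a homology $m$-manifold with boundary if (i) for every nonempty face $F$, $\beta_i(\mathrm{lk}_\Gamma F) = 0$ for $i \neq m-\#F$ and $\beta_{m-\#F}(\mathrm{lk}_\Gamma F) \in \{0,1\}$; (ii) the boundary $\partial\Gamma = \{F \in \Gamma : \beta_i(\mathrm{lk}_\Gamma F)=0 \text{ for all } i\}\cup\{\emptyset\}$ is a homology $(m-1)$-manifold without boundary. Faces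 not in $\partial\Gamma$ are interior faces. A homology $m$-manifold with boundary is $s$-stacked if it has no interior faces of dimension $\le m-s-1$; a homology manifold without boundary is $s$-stacked if it equals $\partial\Sigma$ for some $s$-stacked homology manifold with boundary $\Sigma$. *)

(* Defs.v *)
From HB Require Import structures.
(* all_boot comes last: set0, setT, etc. are then those of finset. *)
From mathcomp Require Import boolp classical_sets cardinality.
From mathcomp Require Import all_boot all_order all_algebra.

Set Implicit Arguments.
Unset Strict Implicit.
Unset Printing Implicit Defensive.

Import Order.TTheory GRing.Theory Num.Theory.
Local Open Scope ring_scope.

Definition infinite_field (k : fieldType) : Prop := infinite_set [set: k]%classic.

(* A simplicial complex is a family of subsets of a finite type T; elements of
   T need not be vertices.  Dimensions and homological degrees are integers,
   so that the empty face has dimension -1. *)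
Section Complexes.

Variable T : finType.
Implicit Types (D : {set {set T}}) (F G : {set T}).

Definition simplicial_complex D : Prop :=
  set0 \in D /\ forall F G, F \in D -> G \subset F -> G \in D.

Definition face_dim F : int := #|F|%:Z - 1.

Definition complex_dim D : int := (\max_(F in D) #|F|)%N%:Z - 1.

Definition pure D (m : int) : Prop :=
  forall F, maxset (fun G => G \in D) F -> face_dim F = m.

Definition link D F : {set {set T}} :=
  [set G in D | (F :|: G \in D) && (F :&: G == set0)].

End Complexes.

Section Homology.

Variables (k : fieldType) (T : finType).
Implicit Types (D : {set {set T}}) (F G : {set T}).

(* The vector space with basis all subsets of T; the chains of a complex, of
   every degree, are subspaces of it, and share one boundary operator. *)
Definition chain := {ffun {set T} -> k^o}.

Definition elem_chain F : chain := [ffun G => (G == F)%:R].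

Definition incidence_sign F (v : T) : k :=
  (-1) ^+ #|[set u in F | (enum_rank u < enum_rank v)%N]|.

Definition diff_fun (c : chain) : chain :=
  \sum_F (c F : k) *:
    \sum_(v in F) incidence_sign F v *: elem_chain (F :\ v).

Fact diff_fun_is_linear : linear diff_fun.
Proof.
move=> a c e; rewrite /diff_fun scaler_sumr -big_split /=.
by apply: eq_bigr => F _; rewrite !ffunE scalerDl scalerA.
Qed.

HB.instance Definition _ :=
  GRing.isLinear.Build k chain chain _ diff_fun diff_fun_is_linear.

Definition diff : 'End(chain) := linfun diff_fun.

Definition chains D (i : int) : {vspace chain} :=
  <<[seq elem_chain F | F in [set F in D | face_dim F == i]]>>%VS.

Definition cycles D (i : int) : {vspace chain} := (chains D i :&: lker diff)%VS.

Definition boundaries D (i : int) : {vspace chain} :=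
  (diff @: chains D (i + 1))%VS.

(* Chains in degree -1 are spanned by the empty face: homology is reduced. *)
Definition betti D (i : int) : nat :=
  (\dim (cycles D i) - \dim (boundaries D i))%N.

Lemma diff_elem F :
  diff (elem_chain F) = \sum_(v in F) incidence_sign F v *: elem_chain (F :\ v).
Proof.
rewrite lfunE /= /diff_fun (bigD1 F) //= ffunE eqxx scale1r.
rewrite [X in _ + X]big1 ?addr0 // => G nGF.
by rewrite ffunE (negPf nGF) scale0r.
Qed.

Lemma incidence_signD1 F v w : v \in F -> w != v ->
  incidence_sign (F :\ v) w =
  (-1) ^+ (enum_rank v < enum_rank w)%N * incidence_sign F w.
Proof.
move=> vF nwv; rewrite /incidence_sign.
set A := [set u in F | _]; have -> :
    [set u in F :\ v | (enum_rank u < enum_rank w)%N] = A :\ v.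
  by apply/setP => u; rewrite !inE andbA.
by rewrite (cardsD1 v A) inE vF /= exprD signrMK.
Qed.

Lemma diff_diff_elem F : diff (diff (elem_chain F)) = 0.
Proof.
pose g (p : T * T) : chain := incidence_sign F p.1 *:
  (incidence_sign (F :\ p.1) p.2 *: elem_chain (F :\ p.1 :\ p.2)).
pose lt (p : T * T) := (enum_rank p.1 < enum_rank p.2)%N.
have -> : diff (diff (elem_chain F)) =
    \sum_(p | (p.1 \in F) && (p.2 \in F :\ p.1)) g p.
  rewrite diff_elem linear_sum.
  rewrite -(pair_big_dep (fun v => v \in F) (fun v w => w \in F :\ v)
    (fun v w => g (v, w))) /=.
  apply: eq_bigr => v _; rewrite linearZ /= diff_elem scaler_sumr.
  by apply: eq_bigr.
pose swap (p : T * T) := (p.2, p.1).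
have swapK : involutive swap by case.
rewrite (bigID lt) /=.
rewrite [X in _ + X](reindex_inj (inv_inj swapK)) /= addrC.
rewrite [X in X + _](_ : _ =
    \sum_(p | (p.1 \in F) && (p.2 \in F :\ p.1) && lt p) - g p).
  by rewrite -big_split big1 //= => p _; rewrite addNr.
apply: eq_big => [[v w]|[v w]]; rewrite /lt /g /= !inE.
  rewrite -leqNgt leq_eqVlt (inj_eq val_inj) (inj_eq enum_rank_inj).
  by rewrite [w == v]eq_sym; case: eqP => /= _; rewrite ?andbF ?[(w \in F) && _]andbC.
case/andP=> /andP[wF /andP[nvw vF]]; rewrite -leqNgt => le_vw.
have lt_vw : (enum_rank v < enum_rank w)%N.
  rewrite ltn_neqAle le_vw andbT (inj_eq val_inj) (inj_eq enum_rank_inj).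
  exact: nvw.
rewrite !incidence_signD1 // 1?eq_sym // lt_vw ltnNge le_vw /=.
rewrite expr0 expr1 mul1r mulN1r scaleNr scalerN opprK !scalerA mulrC.
by congr (_ *: elem_chain _); apply/setP => u; rewrite !inE andbCA.
Qed.

(* Hence the natural-number subtraction in betti is never truncated. *)
Lemma boundaries_sub_cycles D (i : int) :
  simplicial_complex D -> (boundaries D i <= cycles D i)%VS.
Proof.
case=> _ closD; rewrite /boundaries /chains limg_span.
apply/span_subvP => _ /mapP[_ /mapP[F + ->] ->].
rewrite mem_enum inE => /andP[FD /eqP dimF].
rewrite memv_cap memv_ker diff_diff_elem eqxx andbT diff_elem.
apply: memv_suml => v vF; apply/memvZ/memv_span/image_f.
rewrite inE (closD F) ?subD1set //= /face_dim.
move: dimF; rewrite /face_dim (cardsD1 v F) vF PoszD => dimF.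
by rewrite subr_eq -dimF [X in _ == X]addrC addKr.
Qed.

Definition homology_sphere (m : int) D : Prop :=
  [/\ simplicial_complex D, complex_dim D = m &
      forall F, F \in D ->
        (forall i : int, i != m - #|F|%:Z -> betti (link D F) i = 0%N) /\
        betti (link D F) (m - #|F|%:Z) = 1%N].

Definition homology_manifold (m : int) D : Prop :=
  [/\ simplicial_complex D, pure D m &
      forall v : T, [set v] \in D -> homology_sphere (m - 1) (link D [set v])].

Definition boundary_complex D : {set {set T}} :=
  [set F in D | `[< forall i : int, betti (link D F) i = 0%N >]] :|: [set set0].

Definition homology_manifold_with_boundary (m : int) D : Prop :=
  [/\ simplicial_complex D, pure D m,
      forall F, F \in D -> F != set0 ->
        (forall i : int, i != m - #|F|%:Z -> betti (link D F) i = 0%N) /\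
        betti (link D F) (m - #|F|%:Z) \in [:: 0%N; 1%N] &
      homology_manifold (m - 1) (boundary_complex D)].

Definition interior_face D F : Prop := F \in D /\ F \notin boundary_complex D.

Definition stacked_with_boundary (m s : int) D : Prop :=
  homology_manifold_with_boundary m D /\
  forall F, interior_face D F -> ~ (face_dim F <= m - s - 1).

End Homology.

(* S may have vertices outside T, so it lives on an arbitrary finite type U in
   which T embeds.  Its dimension m is forced to be one more than that of D. *)
Definition stacked (k : fieldType) (T : finType) (s : int) (D : {set {set T}}) :
    Prop :=
  exists (U : finType) (f : T -> U) (m : int) (S : {set {set U}}),
    [/\ injective f, stacked_with_boundary k m s S &
        boundary_complex k S = [set f @: F | F : {set T} in D]].

Definition locally_stacked (k : fieldType) (T : finType) (s : int)
    (D : {set {set T}}) : Prop :=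
  forall v : T, [set v] \in D -> stacked k s (link D [set v]).

(* Main.v *)
(* Put X = {F : every subset of F of size at most r + 1 is a face of Delta}.
   The point is that, if S_v fills the link of v in Delta, then lk_X(v) = S_v;
   hence X is a manifold with boundary Delta, and it is stacked because each
   S_v is.

   The links of the nonempty faces of S_v have no homology in degrees >= r - 1:
   it is concentrated in one degree, and vanishes for faces of the boundary,
   which include all those of size at most d - r.  Deleting vertices one at a
   time (Mayer-Vietoris) then kills the homology of S_v in degrees >= r.  Below
   that, S_v has the homology of its boundary, a (d-2)-sphere with the same
   small faces.  So S_v is acyclic, hence (r-1)-Leray, and a Leray complex has
   no missing face of size > r, since deleting the other vertices would leave
   the boundary of a simplex.  This recovers S_v from the link of v. *)
From HB Require Import structures.
Require Import Defs.
From mathcomp Require Import boolp.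
From mathcomp Require Import all_boot all_order all_algebra.
From mathcomp Require Import zify.
Import Order.TTheory GRing.Theory Num.Theory.
Local Open Scope ring_scope.

Set Implicit Arguments.
Unset Strict Implicit.
Unset Printing Implicit Defensive.

(** * Chains and the boundary operator in coordinates *)

Section ChainCoordinates.

Variables (k : fieldType) (T : finType).
Implicit Types (D : {set {set T}}) (F G : {set T}) (c : chain k T) (v : T).

Lemma scale_chainE (a : k) c G : (a *: c) G = a * c G.
Proof. by rewrite ffunE. Qed.

Lemma chain_sum_elem c : c = \sum_F (c F : k) *: elem_chain k F.
Proof.
apply/ffunP => G; rewrite sum_ffunE (bigD1 G) //= !ffunE eqxx.
rewrite big1 ?addr0 ?/(_ *: _) /= ?mulr1 // => F nFG.
by rewrite !ffunE eq_sym (negPf nFG) scaler0.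
Qed.

Lemma chainsP D (i : int) c :
  reflect (forall G, c G != 0 -> G \in D /\ face_dim G = i)
          (c \in chains k D i).
Proof.
apply: (iffP idP) => [cD G | cD].
  rewrite /chains in cD; move: cD; set X := [seq _ | F in _] => cD.
  apply: contraNP => nG.
  rewrite (coord_span (X := in_tuple X) cD) sum_ffunE big1 // => j _.
  rewrite !ffunE; have /mapP[F + ->] : (in_tuple X)`_j \in X by rewrite mem_nth.
  rewrite mem_enum inE ffunE => /andP[FD /eqP dF].
  by case: eqP => [eGF|]; [case: nG; rewrite eGF | rewrite scaler0].
rewrite (chain_sum_elem c); apply: memv_suml => F _.
have [->|/cD[FD /eqP dF]] := eqVneq (c F) 0; first by rewrite scale0r mem0v.
by apply/memvZ/memv_span/image_f; rewrite inE FD.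
Qed.

Lemma incidence_signU1 F v : incidence_sign k (v |: F) v = incidence_sign k F v.
Proof.
rewrite /incidence_sign; congr (_ ^+ #|pred_of_set _|); apply/setP => u.
by rewrite !inE; case: eqP => [->|]; rewrite ?ltnn ?andbF.
Qed.

Lemma incidence_signD1_self F v :
  v \in F -> incidence_sign k (F :\ v) v = incidence_sign k F v.
Proof. by move=> vF; rewrite -incidence_signU1 setD1K. Qed.

Lemma incidence_sign_sqr F v : incidence_sign k F v * incidence_sign k F v = 1.
Proof. by rewrite -expr2 sqrr_sign. Qed.

(** Only the sets [v |: G] have [G] in their boundary, so the coefficient at [G] is a sum over them.
    The cone formula is checked in this pointwise form. *)
Lemma diffE c G :
  diff k T c G = \sum_(v | v \notin G) incidence_sign k G v * c (v |: G).
Proof.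
rewrite lfunE /= /diff_fun sum_ffunE.
transitivity (\sum_(F : {set T}) \sum_(v in F)
    c F * (incidence_sign k F v * (G == F :\ v)%:R)).
  apply: eq_bigr => F _; rewrite scale_chainE sum_ffunE mulr_sumr.
  by apply: eq_bigr => v _; rewrite scale_chainE ffunE.
rewrite (exchange_big_dep xpredT) //= [RHS]big_mkcond /=.
apply: eq_bigr => v _; case: ifPn => [nvG|].
  rewrite (bigD1 (v |: G)) ?setU11 //= setU1K // eqxx mulr1 mulrC.
  rewrite incidence_signU1 big1 ?addr0 // => F /andP[vF /eqP nF].
  by case: eqP => [eG|]; [case: nF; rewrite eG setD1K | rewrite !mulr0].
rewrite negbK => vG; rewrite big1 // => F vF.
by case: eqP => [eG|]; rewrite ?mulr0 //; move: vG; rewrite eG setD11.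
Qed.

End ChainCoordinates.

(** * Cones over chains, and the splitting of a chain at a vertex *)

Section Cone.

Variables (k : fieldType) (T : finType) (v : T).
Implicit Types (D : {set {set T}}) (F G : {set T}) (c : chain k T).

(** The join of [v] with the part of [c] that avoids [v]; the sign moves [v] to the front of each
    face. *)
Definition cone c : chain k T :=
  [ffun G : {set T} =>
    if v \in G then incidence_sign k G v * c (G :\ v) else 0].

(** The [b] in the decomposition [c = a + v * b] with [a] and [b] free of [v]; [deletion_part] is
    the [a]. *)
Definition link_part c : chain k T :=
  [ffun G : {set T} =>
    if v \in G then 0 else incidence_sign k G v * c (v |: G)].

Definition deletion_part c : chain k T :=
  [ffun G : {set T} => if v \in G then 0 else c G].

Lemma incidence_signU1_neq G u w : w \notin G -> u != w ->
  incidence_sign k (w |: G) u =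
  (-1) ^+ (enum_rank w < enum_rank u)%N * incidence_sign k G u.
Proof.
move=> nwG nuw.
by rewrite -{2}(setU1K nwG) incidence_signD1 ?setU11 // signrMK.
Qed.

(** Coning with [v] is a contracting homotopy. *)
Lemma diff_cone c : diff k T (cone c) = c - cone (diff k T c).
Proof.
apply/ffunP => G; rewrite diffE !ffunE.
have [vG|nvG] := boolP (v \in G); last first.
  rewrite subr0 (bigD1 v) //= ffunE setU11 setU1K // incidence_signU1 mulrA.
  rewrite incidence_sign_sqr mul1r big1 ?addr0 // => u /andP[_ nuv].
  by rewrite ffunE !inE eq_sym (negPf nuv) (negPf nvG) mulr0.
have nvGv : v \notin G :\ v by rewrite setD11.
have sG := esym (incidence_signD1_self k vG).
(* The term of [diff c] at [G :\ v] that puts [v] back is [c G] up to sign; after coning it cancels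
   the first summand on the right. *)
rewrite diffE (bigD1 v nvGv) /= setD1K
  // sG mulrDr mulrA incidence_sign_sqr mul1r opprD addNKr.
rewrite mulr_sumr -sumrN; apply: eq_big => u.
  by rewrite !inE negb_and negbK; case: eqP => [->|]; rewrite ?vG ?andbT.
move=> nuG; have nuv : u != v by apply: contraNneq nuG => ->.
have nuGv : u \notin G :\ v by rewrite !inE nuv.
rewrite ffunE !inE vG orbT.
have -> : (u |: G) :\ v = u |: G :\ v.
  by apply/setP => x; rewrite !inE; case: eqP => [->|] //=;
    rewrite eq_sym (negPf nuv).
rewrite incidence_signU1_neq // 1?eq_sym // sG
  -[in incidence_sign k G u](setD1K vG).
rewrite incidence_signU1_neq //.
set a := incidence_sign _ _ u; set b := incidence_sign _ _ v.
rewrite !mulrA -mulNr; congr (_ * _).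
(* The ranks differ, so exactly one of the two comparisons contributes a factor -1. *)
have : nat_of_ord (enum_rank u) != enum_rank v.
  by rewrite (inj_eq val_inj) (inj_eq enum_rank_inj).
by case: ltngtP => // _ _;
  rewrite ?expr0 ?expr1 ?mul1r ?mulN1r ?mulr1 ?mulrN1 !mulNr mulrC.
Qed.

Lemma cone_link_part c : c = deletion_part c + cone (link_part c).
Proof.
apply/ffunP => G; rewrite !ffunE; case: ifPn => vG; last by rewrite addr0.
rewrite setD11 setD1K // add0r mulrA.
by rewrite incidence_signD1_self // incidence_sign_sqr mul1r.
Qed.

End Cone.

(** * Links and vertex deletions *)

Definition deletion (T : finType) (D : {set {set T}}) (v : T) : {set {set T}} :=
  [set F in D | v \notin F].

Section Links.

Variable T : finType.
Implicit Types (D : {set {set T}}) (F G : {set T}) (v : T).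

Lemma in_link D F G :
  simplicial_complex D ->
    (G \in link D F) = (F :|: G \in D) && [disjoint F & G].
Proof.
case=> _ clD; rewrite inE setI_eq0; case FG : (F :|: G \in D);
  rewrite ?andbF //=.
by rewrite (clD _ G FG) ?subsetUr.
Qed.

Lemma in_link1 D v G :
  simplicial_complex D ->
    (G \in link D [set v]) = (v |: G \in D) && (v \notin G).
Proof. by move=> cD; rewrite in_link // disjoints1. Qed.

Lemma link_complex D F :
  simplicial_complex D -> F \in D -> simplicial_complex (link D F).
Proof.
move=> cD FD; split=> [|G H]; rewrite !in_link //.
  by rewrite setU0 FD -setI_eq0 setI0 eqxx.
case/andP=> FG dFG HG; rewrite (disjointWr HG) // andbT.
by case: cD => _; apply; first exact: FG; rewrite setUS.
Qed.

Lemma link_link D F G : simplicial_complex D -> F \in D ->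
  G \in link D F -> link (link D F) G = link D (F :|: G).
Proof.
move=> cD FD GF; apply/setP => H; have cF := link_complex cD FD.
move: GF; rewrite !in_link // setUA => /andP[_ dFG].
by rewrite -!setI_eq0 setIUr setIUl !setU_eq0 setI_eq0 dFG /= -andbA.
Qed.

Lemma link0 D : link D set0 = D.
Proof. by apply/setP => G; rewrite !inE set0U set0I eqxx !andbT andbb. Qed.

Lemma deletion_complex D v :
  simplicial_complex D -> simplicial_complex (deletion D v).
Proof.
case=> D0 clD; split=> [|F G]; rewrite !inE ?D0 //.
by case/andP=> FD vF GF; rewrite (clD F) //=; apply: contra vF; apply: subsetP.
Qed.

Lemma link_deletion D v F : simplicial_complex D -> v \notin F ->
  link (deletion D v) F = deletion (link D F) v.
Proof.
move=> cD vF; apply/setP => G; rewrite !inE (negPf vF) /=.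
by case: (v \in G); rewrite ?andbF ?andbT.
Qed.

End Links.

(** * Vanishing of homology through the Mayer-Vietoris sequence at a vertex *)

Section Vanishing.

Variables (k : fieldType) (T : finType).
Implicit Types (D : {set {set T}}) (F G : {set T}) (c : chain k T) (v : T).

Lemma betti_eq0P D (i : int) : simplicial_complex D ->
  betti k D i = 0%N <->
  forall c, c \in chains k D i -> diff k T c = 0 ->
    exists2 e, e \in chains k D (i + 1) & c = diff k T e.
Proof.
move=> cD; have BZ := boundaries_sub_cycles k i cD;
  split=> [b0 c cD_ dc0|exact_i].
  have : c \in cycles k D i by rewrite memv_cap cD_ memv_ker dc0 eqxx.
  have /eqP <- : boundaries k D i == cycles k D i.
    by rewrite eqEdim BZ -subn_eq0 -[(_ - _)%N]/(betti k D i) b0.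
  by move=> /memv_imgP[e eD ->]; exists e.
apply/eqP; rewrite subn_eq0; apply/dimvS/subvP => c.
rewrite memv_cap memv_ker => /andP[cD_ /eqP/(exact_i c cD_)[e eD ->]].
exact: memv_img.
Qed.

(** Without faces of dimension [i + 1] there are no boundaries, so a nonzero cycle is a nonzero
    class. *)
Lemma betti_neq0 D (i : int) c : c \in chains k D i -> diff k T c = 0 ->
  c != 0 ->
  (forall F, F \in D -> face_dim F != i + 1) -> betti k D i != 0%N.
Proof.
move=> cD dc0 c0 noF; rewrite /betti (_ : boundaries k D i = 0%VS).
  rewrite dimv0 subn0 dimv_eq0; apply: contraNneq c0 => Z0.
  by rewrite -memv0 -Z0 memv_cap cD memv_ker dc0 eqxx.
apply/eqP; rewrite -subv0; apply/subvP => _ /memv_imgP[e eD ->].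
suff -> : e = 0 by rewrite linear0 mem0v.
apply/ffunP => G; rewrite [RHS]ffunE; apply/eqP/negP => /negP.
by move/chainsP: eD => /[apply] -[/noF/eqP].
Qed.

Lemma chainsS D D' (i : int) c : D \subset D' -> c \in chains k D i ->
  c \in chains k D' i.
Proof.
move=> /subsetP sDD' /chainsP cD; apply/chainsP => G /cD[/sDD'].
by [].
Qed.

Lemma diff_chains D (i : int) c : simplicial_complex D ->
  c \in chains k D (i + 1) -> diff k T c \in chains k D i.
Proof.
move=> [_ clD] /chainsP cD; apply/chainsP => G; rewrite diffE => nz.
have [v /andP[vG nz_v]] : exists v, (v \notin G) && (c (v |: G) != 0).
  apply/existsP; apply: contraNT nz => /existsPn nz.
  rewrite big1 // => v vG; move: (nz v); rewrite vG /= negbK => /eqP ->.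
  by rewrite mulr0.
have [GD dG] := cD _ nz_v; rewrite (clD _ _ GD) ?subsetUr //; split=> //.
move: dG; rewrite /face_dim cardsU1 vG; lia.
Qed.

Lemma cone_chains D v (i : int) c : simplicial_complex D ->
  c \in chains k (link D [set v]) i -> cone v c \in chains k D (i + 1).
Proof.
move=> cD /chainsP cL; apply/chainsP => G; rewrite ffunE.
case: ifPn => vG; last by rewrite eqxx.
rewrite mulf_eq0 negb_or => /andP[_ /cL[]].
rewrite in_link1 // setD1K // => /andP[-> _];
  rewrite /face_dim (cardsD1 v G) vG.
by split=> //; lia.
Qed.

Lemma link_part_chains D v (i : int) c : simplicial_complex D ->
  c \in chains k D (i + 1) -> link_part v c \in chains k (link D [set v]) i.
Proof.
move=> cD /chainsP cL; apply/chainsP => G; rewrite ffunE.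
case: ifPn => vG; first by rewrite eqxx.
rewrite mulf_eq0 negb_or => /andP[_ /cL[vGD]].
by rewrite in_link1 // vGD vG /face_dim cardsU1 vG; split=> //; lia.
Qed.

Lemma deletion_part_chains D v (i : int) c :
  c \in chains k D i -> deletion_part v c \in chains k (deletion D v) i.
Proof.
move=> /chainsP cL; apply/chainsP => G; rewrite ffunE.
by case: ifPn => vG; rewrite ?eqxx // inE vG => /cL[-> ->].
Qed.

Lemma link_sub_deletion D v :
  simplicial_complex D -> link D [set v] \subset deletion D v.
Proof.
move=> cD; apply/subsetP => G; rewrite in_link1 // inE => /andP[vG ->].
by case: cD => _ /(_ _ _ vG) ->; rewrite ?subsetUr.
Qed.

Lemma deletion_sub D v : deletion D v \subset D.
Proof. by apply/subsetP => G; rewrite inE => /andP[]. Qed.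

(** A cone is supported on faces through [v], a chain of a deletion on faces avoiding [v]. This
    separates a boundary equation into its two parts. *)
Lemma cone_eq_deletion D D' v (i j : int) a b :
  a \in chains k (deletion D v) i -> b \in chains k (deletion D' v) j ->
  a = cone v b -> b = 0.
Proof.
move=> /chainsP aD /chainsP bD ab; apply/ffunP => G; rewrite [RHS]ffunE.
apply/eqP/negP => /negP bG; have [] := bD G bG; rewrite inE => /andP[_ vG] _.
have /aD[] : a (v |: G) != 0.
  by rewrite ab ffunE setU11 setU1K // mulf_neq0 // signr_eq0.
by rewrite inE setU11 andbF.
Qed.

Lemma cone0 v : cone v (0 : chain k T) = 0.
Proof. by apply/ffunP => G; rewrite !ffunE mulr0 if_same. Qed.

(** Exactness of H_i(lk v) -> H_i(D - v) -> H_i(D) in the middle. If a cycle [c] of the deletion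
    bounds [a + v * b] in [D], then [b] is a cycle of the link; writing it as the boundary of [b'],
    [c] bounds [a + b']. *)
Lemma betti_deletion_eq0 D v (i : int) : simplicial_complex D ->
  [set v] \in D ->
  betti k D i = 0%N -> betti k (link D [set v]) i = 0%N ->
  betti k (deletion D v) i = 0%N.
Proof.
move=> cD vD /betti_eq0P D0 /betti_eq0P L0.
have cL := link_complex cD vD; have cX := deletion_complex v cD.
apply/betti_eq0P => // c cXi dc0.
have [] // := D0 cD c => [|e eD ce];
  first exact: chainsS (deletion_sub D v) cXi.
have aX := deletion_part_chains v eD; have bL := link_part_chains v cD eD.
move: ce; rewrite {1}(cone_link_part v e) linearD /= diff_cone.
move: aX bL; set a := deletion_part _ _; set b := link_part _ _ => aX bL ce.
have dbL : diff k T b \in chains k (link D [set v]) (i - 1).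
  by apply: diff_chains; rewrite ?subrK.
have sLX := link_sub_deletion v cD.
have db0 : diff k T b = 0.
  apply: (@cone_eq_deletion D D v i _ (diff k T a + b - c)).
  - rewrite memvB // memvD ?diff_chains //; exact: chainsS bL.
  - exact: chainsS dbL.
  - by rewrite ce addrA opprB addrCA subrr addr0.
have [b' b'L eb] := L0 cL b bL db0.
exists (a + b'); first by rewrite memvD // (chainsS sLX).
by rewrite ce db0 cone0 subr0 linearD /= -eb.
Qed.

(** Exactness of H_i(D - v) -> H_i(D) -> H_{i-1}(lk v) in the middle: modulo a boundary, a cycle
    [a + v * b] becomes the cycle [a + b'] of the deletion, where [b'] bounds [b] in the link. *)
Lemma betti_eq0_of_deletion D v (i : int) :
  simplicial_complex D -> [set v] \in D ->
  betti k (deletion D v) i = 0%N -> betti k (link D [set v]) (i - 1) = 0%N ->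
  betti k D i = 0%N.
Proof.
move=> cD vD /betti_eq0P X0 /betti_eq0P L0.
have cL := link_complex cD vD; have cX := deletion_complex v cD.
have sLX := link_sub_deletion v cD.
apply/betti_eq0P => // c cDi dc0.
have cDi' : c \in chains k D (i - 1 + 1) by rewrite subrK.
have aX := deletion_part_chains v cDi; have bL := link_part_chains v cD cDi'.
move: dc0; rewrite {1 2}(cone_link_part v c).
move: aX bL; set a := deletion_part _ _; set b := link_part _ _ => aX bL.
rewrite linearD /= diff_cone => dc0.
have dbL : diff k T b \in chains k (link D [set v]) (i - 1 - 1).
  by apply: diff_chains; rewrite ?subrK.
have daX : diff k T a \in chains k (deletion D v) (i - 1).
  by apply: diff_chains; rewrite ?subrK.
have db0 : diff k T b = 0.
  apply: (@cone_eq_deletion D D v (i - 1) _ (diff k T a + b)).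
  - by rewrite memvD // (chainsS sLX).
  - exact: chainsS dbL.
  - by apply/eqP; rewrite -subr_eq0 -addrA dc0.
have [b' b'L eb] := L0 cL b bL db0; rewrite subrK in b'L.
move: dc0; rewrite db0 cone0 subr0 => dab0.
have [||e eX ee] := X0 cX (a + b').
- by rewrite memvD // (chainsS sLX).
- by rewrite linearD /= -eb.
(* The boundary of [v * b'] is [b' - v * b], so subtracting it from [a + b'] leaves [a + v * b]. *)
exists (e - cone v b').
  by rewrite memvB ?(chainsS (deletion_sub D v) eX) ?cone_chains.
by rewrite linearB /= diff_cone -eb -ee opprB addrCA addrK addrC.
Qed.

End Vanishing.

(** * Leray complexes *)

Section Leray.

Variables (k : fieldType) (T : finType).
Implicit Types (D : {set {set T}}) (F G : {set T}) (v : T) (l i : int).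

(** The Leray condition in its form for links; the usual form asks for vanishing on induced
    subcomplexes. *)
Definition leray D l : Prop :=
  forall F, F \in D -> forall i, l <= i -> betti k (link D F) i = 0%N.

(** The part of the Leray condition available before anything is known on the homology of [D], the
    link of the empty face. *)
Definition nonempty_links_vanish D l : Prop :=
  forall F, F \in D -> F != set0 -> forall i, l <= i ->
    betti k (link D F) i = 0%N.

(** Deleting [v] commutes with passing to the link of [F], where the link of [v] is that of
    [v |: F]. If [v |: F] is not a face, the link of [F] is unchanged. *)
Lemma betti_link_deletion_eq0 D F v i :
  simplicial_complex D -> F \in deletion D v -> betti k (link D F) i = 0%N ->
  (v |: F \in D -> betti k (link D (v |: F)) i = 0%N) ->
  betti k (link (deletion D v) F) i = 0%N.
Proof.
move=> cD; rewrite inE => /andP[FD vF] bF bvF; rewrite link_deletion //.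
have cF := link_complex cD FD.
have vL : ([set v] \in link D F) = (v |: F \in D).
  by rewrite in_link // setUC disjoint_sym disjoints1 vF andbT.
have [vFD|vFD] := boolP (v |: F \in D).
  apply: betti_deletion_eq0 => //; rewrite ?vL // link_link ?vL //.
  by rewrite setUC bvF.
rewrite (_ : deletion _ v = link D F) //; apply/setP => G.
rewrite inE; case GF : (G \in link D F) => //=; apply: contra vFD => vG.
by rewrite -vL; case: cF => _; apply; first exact: GF; rewrite sub1set.
Qed.

Lemma leray_deletion D v l : simplicial_complex D -> leray D l ->
  leray (deletion D v) l.
Proof.
move=> cD lD F FX i li; apply: betti_link_deletion_eq0 => //.
  by apply: lD => //; move: FX; rewrite inE => /andP[].
by move=> vFD; apply: lD.
Qed.

Lemma nonempty_links_vanish_deletion D v l : simplicial_complex D ->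
  nonempty_links_vanish D l -> nonempty_links_vanish (deletion D v) l.
Proof.
move=> cD lD F FX F0 i li; apply: betti_link_deletion_eq0 => //.
  by apply: lD => //; move: FX; rewrite inE => /andP[].
by move=> vFD; apply: lD => //; apply/set0Pn; exists v; rewrite setU11.
Qed.

Lemma card_deletion D v : [set v] \in D -> (#|deletion D v| < #|D|)%N.
Proof.
move=> vD; apply/proper_card/properP; split; first exact: deletion_sub.
by exists [set v]; rewrite // inE set11 andbF.
Qed.

(** Induction over vertex deletions: H_i(D) is squeezed between H_i(D - v) and H_{i-1}(lk v), and
    [l <= i - 1] is why [i] must exceed [l]. *)
Lemma betti_eq0_of_links D l : simplicial_complex D -> 0 <= l ->
  nonempty_links_vanish D l -> forall i, l < i -> betti k D i = 0%N.
Proof.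
move=> + l0; move En : #|D| => n.
elim/ltn_ind: n D En => n IHn D En cD lD i li.
have [/existsP[v vD]|/existsPn noV] := boolP [exists v, [set v] \in D].
  apply: (betti_eq0_of_deletion cD vD).
    apply: (IHn _ _ _ erefl) => //; first by rewrite -En card_deletion.
      exact: deletion_complex.
    exact: nonempty_links_vanish_deletion.
  by apply: lD => //; [apply/set0Pn; exists v; rewrite set11 | lia].
(* Without vertices only the empty face can remain, and [0 <= l < i] excludes its degree. *)
apply/betti_eq0P => // c /chainsP cDi _.
exists 0; rewrite ?mem0v // linear0; apply/ffunP => G; rewrite [RHS]ffunE.
apply/eqP/negP => /negP /cDi[GD dG].
have [u uG] : exists u, u \in G.
  by apply/card_gt0P; move: dG; rewrite /face_dim; lia.
have /negP[] := noV u; case: cD => _; apply; first exact: GD.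
by rewrite sub1set.
Qed.

Lemma diff_elem_neq0 F v : v \in F -> diff k T (elem_chain k F) != 0.
Proof.
move=> vF; apply/eqP => /ffunP/(_ (F :\ v)); rewrite diffE [RHS]ffunE.
rewrite (bigD1 v) ?setD11 //= setD1K // big1 => [|u /andP[_ nuv]].
  by rewrite ffunE eqxx mulr1 addr0 => /eqP; rewrite signr_eq0.
rewrite ffunE; case: eqP => [/setP/(_ v)|]; rewrite ?mulr0 // !inE eqxx vF orbF.
by rewrite eq_sym (negPf nuv).
Qed.

(* With all its proper faces present, a non-face induces the boundary of a
   simplex, which has homology in degree [dim F - 1]. *)
Lemma leray_missing_face D l F : simplicial_complex D -> leray D l ->
  F \notin D -> (forall G, G \proper F -> G \in D) -> face_dim F <= l.
Proof.
move En : #|D| => n; elim/ltn_ind: n D En => n IHn D En cD lD FD pF.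
have [/existsP[v /andP[vF vD]]|/existsPn noV] :=
    boolP [exists v, (v \notin F) && ([set v] \in D)].
  apply: (IHn _ _ (deletion D v) erefl); first by rewrite -En card_deletion.
  - exact: deletion_complex.
  - exact: leray_deletion.
  - by rewrite inE (negPf FD).
  move=> G GF; rewrite inE pF //=; apply: contra vF; apply: subsetP.
  exact: proper_sub.
have [D0 clD] := cD.
have subF G : G \in D -> G \subset F.
  move=> GD; apply/subsetP => v vG; have := noV v; apply: contraNT => ->.
  by rewrite (clD G) // sub1set.
have [F0|[v vF]] := set_0Vmem F; first by move: FD; rewrite F0 D0.
rewrite leNgt; apply/negP => lF; have lF1 : l <= face_dim F - 1 by lia.
have := lD _ D0 _ lF1; rewrite link0; apply/eqP.
have cpF : simplicial_complex (powerset F).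
  split=> [|G H]; rewrite !powersetE ?sub0set //.
  by move=> GF HG; apply: subset_trans HG GF.
apply: (@betti_neq0 _ _ _ _ (diff k T (elem_chain k F))).
- apply/chainsP => G nz; have /chainsP/(_ G nz)[] :
      diff k T (elem_chain k F) \in chains k (powerset F) (face_dim F - 1).
    apply: diff_chains => //; apply/chainsP => H; rewrite subrK ffunE.
    by case: (H =P F) => [->|_]; rewrite ?eqxx // powersetE.
  rewrite powersetE => GF dG; split=> //; apply: pF.
  rewrite properEcard GF /=; move: dG; rewrite /face_dim; lia.
- exact: diff_diff_elem.
- exact: diff_elem_neq0 vF.
move=> G GD; rewrite subrK; apply: contraNneq FD => dG.
suff /eqP <- : G == F by [].
by rewrite eqEcard subF //; move: dG; rewrite /face_dim; lia.
Qed.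

(** By induction the proper subsets of [F] are faces. Were [F] not one, it would be a missing face,
    hence of dimension at most [l], and the hypothesis would apply to [F] itself. *)
Lemma leray_flag D l F : simplicial_complex D -> leray D l ->
  (forall G, G \subset F -> face_dim G <= l -> G \in D) -> F \in D.
Proof.
move=> cD lD; move En : #|F| => n; elim/ltn_ind: n F En => n IHn F En sF.
apply: contraT => FD; rewrite -(negPf FD); apply: (sF) => //.
apply: (leray_missing_face cD lD FD) => G pGF.
apply: (IHn _ _ G erefl); first by rewrite -En proper_card.
by move=> H HG; apply: sF; apply: subset_trans HG (proper_sub pGF).
Qed.

End Leray.

(** * Invariance of homology under injective relabeling *)

Section Relabeling.

Variables (k : fieldType) (T U : finType) (f : T -> U).
Hypothesis f_inj : injective f.
Implicit Types (D : {set {set T}}) (F G : {set T}) (c : chain k T).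

Definition relabel D : {set {set U}} := [set f @: F | F : {set T} in D].

(** Faces are oriented by [enum_rank], whose order [f] may reverse; the parity of this number
    corrects the orientation and makes relabeling a chain map. *)
Definition inversions F : nat :=
  (\sum_(u in F) \sum_(w in F)
    ((enum_rank u < enum_rank w) && (enum_rank (f w) < enum_rank (f u))))%N.

Definition relabel_sign F : k := (-1) ^+ inversions F.

Definition relabel_chain_fun c : chain k U :=
  \sum_F (c F : k) *: (relabel_sign F *: elem_chain k (f @: F)).

Fact relabel_chain_fun_is_linear : linear relabel_chain_fun.
Proof.
move=> a c e; rewrite /relabel_chain_fun scaler_sumr -big_split /=.
by apply: eq_bigr => F _; rewrite !ffunE scalerDl [a *: (_ *: _)]scalerA.
Qed.

HB.instance Definition _ := GRing.isLinear.Build k (chain k T) (chain k U) _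
  relabel_chain_fun relabel_chain_fun_is_linear.

Definition relabel_chain : 'Hom(chain k T, chain k U) :=
  linfun relabel_chain_fun.

Lemma incidence_signE (V : finType) (F : {set V}) v :
  incidence_sign k F v = (-1) ^+ (\sum_(u in F) (enum_rank u < enum_rank v))%N.
Proof.
rewrite /incidence_sign -sum1dep_card big_mkcondr /=; congr (_ ^+ _).
Qed.

Lemma inversionsD1 F v : v \in F ->
  inversions F = (inversions (F :\ v) +
    \sum_(u in F) ((enum_rank u < enum_rank v) &&
                   (enum_rank (f v) < enum_rank (f u))) +
    \sum_(u in F) ((enum_rank v < enum_rank u) &&
                   (enum_rank (f u) < enum_rank (f v))))%N.
Proof.
move=> vF; rewrite /inversions.
rewrite (big_setD1 v) //= addnC; congr addn.
under eq_bigr => u uF do rewrite (big_setD1 v) //= addnC.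
rewrite big_split /=; congr addn.
by rewrite [RHS](big_setD1 v) //= ltnn.
Qed.

Lemma relabel_signD1 F v : v \in F ->
  relabel_sign F * incidence_sign k (f @: F) (f v) =
  incidence_sign k F v * relabel_sign (F :\ v).
Proof.
move=> vF; rewrite !incidence_signE /relabel_sign -!exprD (inversionsD1 vF).
rewrite (big_imset _ (in2W f_inj)) /= -signr_odd -[RHS]signr_odd.
congr (_ ^+ nat_of_bool _); rewrite -!addnA !oddD addbC; congr addb.
rewrite -!oddD -!big_split /=.
(* For each [u] the exponents differ by twice an inversion with [v] before [u], which is even. *)
rewrite (eq_bigr (fun u => (enum_rank u < enum_rank v) +
  2 * ((enum_rank v < enum_rank u) && (enum_rank (f u) < enum_rank (f v))))%N).
  by rewrite big_split -big_distrr oddD oddM addbF.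
move=> u uF; have [->|nuv] := eqVneq u v; first by rewrite !ltnn.
have : nat_of_ord (enum_rank u) != enum_rank v.
  by rewrite (inj_eq val_inj) (inj_eq enum_rank_inj).
have : nat_of_ord (enum_rank (f u)) != enum_rank (f v).
  by rewrite (inj_eq val_inj) (inj_eq enum_rank_inj) (inj_eq f_inj).
case: (ltngtP (enum_rank (f u)) (enum_rank (f v))) => // _ _.
  by case: (ltngtP (enum_rank u) (enum_rank v)).
by case: (ltngtP (enum_rank u) (enum_rank v)).
Qed.

Lemma relabel_chain_elem F :
  relabel_chain (elem_chain k F) = relabel_sign F *: elem_chain k (f @: F).
Proof.
rewrite lfunE /= /relabel_chain_fun (bigD1 F) //= ffunE eqxx scale1r.
rewrite big1 ?addr0 // => G nGF.
by rewrite ffunE (negPf nGF) scale0r.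
Qed.

Lemma diff_relabel : (diff k U \o relabel_chain)%VF =
  (relabel_chain \o diff k T)%VF.
Proof.
apply/lfunP => c; rewrite (chain_sum_elem c) !linear_sum; apply: eq_bigr => F _.
rewrite !linearZ /=; congr (_ *: _); rewrite !comp_lfunE relabel_chain_elem.
rewrite linearZ /= !diff_elem !linear_sum /= (big_imset _ (in2W f_inj)) /=.
apply: eq_bigr => v vF; rewrite [in RHS]linearZ /= relabel_chain_elem !scalerA.
rewrite relabel_signD1 //; congr (_ *: elem_chain k _).
apply/setP => u; rewrite !inE; apply/andP/imsetP => [[nuv /imsetP[w wF uE]]|].
  by exists w; rewrite // !inE wF andbT; apply: contraNneq nuv;
    rewrite uE => ->.
move=> [w]; rewrite !inE => /andP[nwv wF] ->.
by rewrite (inj_eq f_inj) nwv imset_f.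
Qed.

Lemma relabel_chainE c F : relabel_chain c (f @: F) = relabel_sign F * c F.
Proof.
rewrite lfunE /= /relabel_chain_fun sum_ffunE (bigD1 F) //= big1 ?addr0.
  by rewrite !scale_chainE ffunE eqxx mulr1 mulrC.
move=> G nGF; rewrite !scale_chainE ffunE (inj_eq (imset_inj f_inj)).
by rewrite eq_sym (negPf nGF) !mulr0.
Qed.

Lemma lker_relabel_chain : lker relabel_chain = 0%VS.
Proof.
apply/eqP; rewrite -subv0; apply/subvP => c; rewrite memv_ker memv0 => /eqP c0.
apply/eqP/ffunP => F; have := relabel_chainE c F;
  rewrite c0 !ffunE => /esym/eqP.
by rewrite mulf_eq0 signr_eq0 => /eqP.
Qed.

Lemma relabel_chains D (i : int) :
  chains k (relabel D) i = (relabel_chain @: chains k D i)%VS.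
Proof.
have dimf F : face_dim (f @: F) = face_dim F by rewrite /face_dim card_imset.
apply/eqP; rewrite eqEsubv; apply/andP; split.
  apply/span_subvP => _ /mapP[G + ->]; rewrite mem_enum inE.
  case/andP=> /imsetP[F FD ->]; rewrite dimf => dF.
  rewrite -[elem_chain k _](signrZK (inversions F)) -/(relabel_sign F).
  rewrite -relabel_chain_elem; apply/memvZ/memv_img/memv_span/image_f.
  by rewrite inE FD.
rewrite limg_span; apply/span_subvP => _ /mapP[_ /mapP[F + ->] ->].
rewrite mem_enum inE => /andP[FD dF]; rewrite relabel_chain_elem.
by apply/memvZ/memv_span/image_f; rewrite inE imset_f // dimf.
Qed.

(** [relabel_chain] is an injective chain map onto the relabeled chains, so it carries cycles onto
    cycles and boundaries onto boundaries. *)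
Lemma betti_relabel D (i : int) : betti k (relabel D) i = betti k D i.
Proof.
have dimf (V : {vspace chain k T}) : \dim (relabel_chain @: V) = \dim V.
  by apply: limg_dim_eq; rewrite lker_relabel_chain capv0.
have Ecycles : cycles k (relabel D) i = (relabel_chain @: cycles k D i)%VS.
  apply/eqP; rewrite eqEsubv; apply/andP; split; apply/subvP => y.
    rewrite memv_cap relabel_chains memv_ker => /andP[/memv_imgP[c cD ->]].
    rewrite -comp_lfunE diff_relabel comp_lfunE -memv_ker lker_relabel_chain.
    by rewrite memv0 => dc0; rewrite memv_img // memv_cap cD memv_ker.
  move=> /memv_imgP[c + ->]; rewrite memv_cap memv_ker => /andP[cD /eqP dc0].
  rewrite memv_cap relabel_chains memv_img //=
    memv_ker -comp_lfunE diff_relabel.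
  by rewrite comp_lfunE dc0 linear0.
rewrite /betti Ecycles (_ : boundaries k (relabel D) i =
  (relabel_chain @: boundaries k D i)%VS) ?dimf //.
by rewrite /boundaries relabel_chains -!limg_comp diff_relabel.
Qed.

End Relabeling.

Lemma link_relabel (T U : finType) (f : T ->
  U) (D : {set {set T}}) (F : {set T}) :
  injective f -> link (relabel f D) (f @: F) = relabel f (link D F).
Proof.
move=> f_inj; apply/setP => G; rewrite inE; apply/and3P/imsetP => [[]|].
  move=> /imsetP[H HD ->]; rewrite -imsetU -imsetI; last exact: in2W.
  rewrite mem_imset ?imset_eq0; last exact: imset_inj.
  by move=> FHD FH; exists H; rewrite // inE HD FHD.
move=> [H + ->]; rewrite inE => /and3P[HD FHD FH].
by rewrite -imsetU -imsetI ?imset_eq0 ?imset_f //; exact: in2W.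
Qed.

(** * Purity, boundaries and vertex links of homology manifolds *)

Section Manifolds.

Variables (k : fieldType) (T : finType).
Implicit Types (D S : {set {set T}}) (F G : {set T}) (v : T) (m n s i : int).

Lemma maxset_above D F : F \in D ->
  exists2 M, maxset (fun G => G \in D) M & F \subset M.
Proof. by move=> FD; have [M] := maxset_exists (P := fun G => G \in D) FD;
  exists M. Qed.

Lemma link_maxset D F : simplicial_complex D -> maxset (fun G => G \in D) F ->
  link D F = [set set0].
Proof.
move=> cD /maxsetP[FD maxF]; apply/setP => G; rewrite in_link // inE.
apply/andP/eqP => [[FGD dFG]|->]; last by rewrite setU0 -setI_eq0 setI0.
have GF : G \subset F by rewrite -(maxF _ FGD (subsetUl F G)) subsetUr.
by apply/eqP; rewrite -(setIidPr GF) setI_eq0.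
Qed.

Lemma betti_set0_neq0 : betti k [set set0 : {set T}] (-1) != 0%N.
Proof.
apply: (@betti_neq0 _ _ _ _ (elem_chain k set0)).
- apply/chainsP => G; rewrite ffunE inE; case: (G =P set0) => [->|_];
  last by rewrite eqxx.
  by rewrite /face_dim cards0.
- by rewrite diff_elem big_set0.
- by apply/eqP => /ffunP/(_ set0)/eqP; rewrite !ffunE eqxx oner_eq0.
- by move=> F; rewrite inE => /eqP ->; rewrite /face_dim cards0.
Qed.

Lemma face_dim_le_complex_dim D F : F \in D -> face_dim F <= complex_dim D.
Proof.
move=> FD; rewrite /face_dim /complex_dim lerD2r lez_nat.
exact: (@leq_bigmax_cond _ (fun G => G \in D) (fun G : {set T} => #|G|)%N F FD).
Qed.

Lemma pure_complex_dim D m : set0 \in D -> pure D m -> complex_dim D = m.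
Proof.
move=> D0 pD; have [M maxM _] := maxset_above D0; have dM := pD M maxM.
have [MD _] := maxsetP maxM; have := face_dim_le_complex_dim MD.
suff : (\max_(F in D) #|F| <= #|M|)%N by rewrite -dM /complex_dim /face_dim;
  lia.
apply/bigmax_leqP => F /maxset_above[M' /pD dM' /subset_leq_card].
by move: dM dM'; rewrite /face_dim; lia.
Qed.

Lemma face_dimD1 F v : v \in F -> face_dim (F :\ v) = face_dim F - 1.
Proof. by move=> vF; rewrite /face_dim (cardsD1 v F) vF; lia. Qed.

Lemma pure_link D m v : simplicial_complex D -> pure D m ->
  [set v] \in D -> pure (link D [set v]) (m - 1).
Proof.
move=> cD pD vD F /maxsetP[]; rewrite in_link1 // => /andP[vFD vF] maxF.
rewrite -(pD (v |: F)) -?(face_dimD1 (setU11 v F)) ?setU1K //.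
apply/maxsetP; split=> // G GD; rewrite subUset sub1set => /andP[vG FG].
rewrite -(maxF (G :\ v)) ?setD1K //.
  by rewrite in_link1 // setD1K // GD setD11.
by rewrite subsetD1 FG.
Qed.

(** The link of a facet [F] is the complex of the empty face, with homology in degree -1; the sphere
    condition only allows degree [m - #|F|]. *)
Lemma homology_sphere_pure m D : homology_sphere k m D -> pure D m.
Proof.
move=> [cD dD lD] F maxF; have [FD _] := maxsetP maxF.
have [+ _] := lD F FD; rewrite link_maxset // => /(_ (-1)) b0.
have [e|/b0/eqP] := eqVneq (-1 : int) (m - #|F|%:Z).
  by rewrite /face_dim; lia.
by rewrite (negPf betti_set0_neq0).
Qed.

Lemma homology_sphere_manifold m D : homology_sphere k m D ->
  homology_manifold k m D.
Proof.
move=> sD; have [cD dD lD] := sD; have pD := homology_sphere_pure sD.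
split=> // v vD; have cL := link_complex cD vD; split=> //.
  by apply: pure_complex_dim; [case: cL | exact: pure_link].
move=> F FL; rewrite link_link //; move: FL;
  rewrite in_link1 // => /andP[vFD vF].
have := lD _ vFD; rewrite cardsU1 vF.
by rewrite (_ : m - (1 + #|F|)%N%:Z = m - 1 - #|F|%:Z) //; lia.
Qed.

Lemma in_boundary D F : F != set0 ->
  F \in boundary_complex k D <-> F \in D /\
    forall i, betti k (link D F) i = 0%N.
Proof.
move=> F0; rewrite !inE (negPf F0) orbF.
by split=> [/andP[-> /asboolP]|[-> ?]]; last by apply/asboolP.
Qed.

Lemma set0_boundary D : set0 \in boundary_complex k D.
Proof. by rewrite !inE eqxx orbT. Qed.

Lemma boundary_sub D F : set0 \in D -> F \in boundary_complex k D -> F \in D.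
Proof. by move=> D0; rewrite !inE => /orP[/andP[]|/eqP ->]. Qed.

(** A nonempty [F] in the link of [v] and [v |: F] in [S] have the same link. The empty face lies on
    both sides because [v] is a boundary vertex. *)
Lemma boundary_link S v : simplicial_complex S ->
  simplicial_complex (boundary_complex k S) ->
    [set v] \in boundary_complex k S ->
  boundary_complex k (link S [set v]) = link (boundary_complex k S) [set v].
Proof.
move=> cS cB vB; have [S0 _] := cS; have vS := boundary_sub S0 vB.
apply/setP => F; rewrite [RHS]in_link1 //.
have [->|F0] := eqVneq F set0; first by rewrite set0_boundary setU0 vB inE.
have vF0 : v |: F != set0 by apply/set0Pn; exists v; rewrite setU11.
apply/idP/andP.
  move=> /(in_boundary _ F0)[FL bF]; rewrite link_link // in bF.
  move: FL; rewrite in_link1 // => /andP[vFS vF]; split=> //.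
  exact/(in_boundary _ vF0).
move=> [/(in_boundary _ vF0)[vFS bF] vF].
have FL : F \in link S [set v] by rewrite in_link1 // vFS.
by apply/(in_boundary _ F0); rewrite link_link.
Qed.

(** An interior face [F] of the link yields the interior face [v |: F], one dimension higher, which
    matches the drop from [m] to [m - 1]. *)
Lemma stacked_with_boundary_link m s S v :
  stacked_with_boundary k m s S -> [set v] \in boundary_complex k S ->
  stacked_with_boundary k (m - 1) s (link S [set v]).
Proof.
move=> [[cS pS lS mB] iS] vB; have [cB pB sB] := mB.
have [S0 _] := cS; have vS := boundary_sub S0 vB.
have bL := boundary_link cS cB vB.
have cL := link_complex cS vS; split; last first.
  move=> F []; rewrite bL !in_link1 // => /andP[vFS vF];
    rewrite vF andbT => nvFB.
  have := iS (v |: F) (conj vFS nvFB).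
  by rewrite -{2}(setU1K vF) face_dimD1 ?setU11 //; lia.
split=> //.
- exact: pure_link.
- move=> F FL F0; rewrite link_link //.
  move: FL; rewrite in_link1 // => /andP[vFS vF].
  have vF0 : v |: F != set0 by apply/set0Pn; exists v; rewrite setU11.
  have := lS _ vFS vF0; rewrite cardsU1 vF.
  by rewrite (_ : m - (1 + #|F|)%N%:Z = m - 1 - #|F|%:Z) //; lia.
- by rewrite bL; apply/homology_sphere_manifold/sB.
Qed.

Lemma eq_chains D D' i : (forall F, face_dim F = i -> (F \in D) = (F \in D')) ->
  chains k D i = chains k D' i.
Proof.
move=> eD; rewrite /chains (_ : [set F in D | _] = [set F in D' | face_dim F ==
  i]) //.
by apply/setP => F; rewrite !inE; case: (face_dim F =P i) => [/eD ->|];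
  rewrite ?andbF.
Qed.

(** * Stacked manifolds bounded by a sphere *)

Section StackedBall.

Variables (n s : int) (S : {set {set T}}).
Hypotheses (s_ge0 : 0 <= s) (le_s_n : 2 * (s + 1) <= n).
Hypothesis S_stacked : stacked_with_boundary k n s S.
Hypothesis boundary_sphere : homology_sphere k (n - 1) (boundary_complex k S).

Lemma stacked_small_face F : F \in S -> face_dim F <= n - s - 1 ->
  F \in boundary_complex k S.
Proof.
move=> FS dF; have [_ iS] := S_stacked.
by apply: contraT => nFB; case: (iS F).
Qed.

Lemma stacked_nonempty_links : nonempty_links_vanish k S s.
Proof.
have [[_ _ lS _] _] := S_stacked.
move=> F FS F0 i si; have [/(in_boundary _ F0)[_ ->]//|nFB] :=
  boolP (F \in boundary_complex k S).
have [+ _] := lS F FS F0; apply.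
(* If [i = n - #|F|], then [s <= i] gives [F] dimension at most [n - s - 1], so it lies on the
   boundary. *)
apply: contraNneq nFB => ei; apply: stacked_small_face => //.
by rewrite /face_dim; lia.
Qed.

(* Above degree [s] homology is killed by the links; up to degree [s] the
   complex has the same faces, hence the same homology, as its boundary. *)
Lemma stacked_acyclic i : betti k S i = 0%N.
Proof.
have [[cS _ _ _] _] := S_stacked; have [S0 _] := cS.
have [si|si] := ltP s i.
  exact: (betti_eq0_of_links cS s_ge0 stacked_nonempty_links).
(* Boundaries in degree [i <= s] involve chains of degree up to [s + 1], and
   [s + 1 <= n - s - 1]. *)
have eq_dim j : j <= s + 1 -> chains k S j = chains k (boundary_complex k S) j.
  move=> js; apply: eq_chains => F dF; apply/idP/idP => [FS|];
    last exact: boundary_sub.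
  by apply: stacked_small_face; rewrite // dF; lia.
have -> : betti k S i = betti k (boundary_complex k S) i.
  by rewrite /betti /cycles /boundaries !eq_dim //; lia.
have [_ _ /(_ _ (set0_boundary S))[+ _]] := boundary_sphere.
by rewrite link0 cards0; apply; apply/eqP; lia.
Qed.

Lemma stacked_leray : leray k S s.
Proof.
move=> F FS i si; have [->|F0] := eqVneq F set0;
  last exact: stacked_nonempty_links.
by rewrite link0 stacked_acyclic.
Qed.

End StackedBall.

End Manifolds.

(* No interior face being a vertex, a stacked filling has all its vertices on
   the boundary, so it can be pulled back to the vertex set of the boundary. *)
Lemma stacked_on_vertices (k : fieldType) (T : finType) (n s : int)
    (D : {set {set T}}) :
  homology_manifold k (n - 1) D -> s + 1 <= n -> stacked k s D ->
  exists2 S : {set {set T}}, stacked_with_boundary k n s S &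
    boundary_complex k S = D.
Proof.
move=> mD sn [U [f [m [S [f_inj [[cS pS lS [cB pB sB]] iS] bS]]]]].
have [cD pD _] := mD; have [D0 clD] := cD; have [S0 clS] := cS.
rewrite -/(relabel f D) in bS.
have f_inj2 := imset_inj f_inj.
have dimf (F : {set T}) : face_dim (f @: F) = face_dim F.
  by rewrite /face_dim card_imset.
(* A facet of [D] maps to a facet of the boundary; purity of both complexes compares the
   dimensions. *)
have em : m = n.
  have [M maxM _] := maxset_above D0; have [MD maxM'] := maxsetP maxM.
  have /pB : maxset (fun G => G \in boundary_complex k S) (f @: M).
    rewrite bS; apply/maxsetP; split=> [|_ /imsetP[F FD ->] MF].
      exact: imset_f.
    rewrite (maxM' F) //; apply/subsetP => u uM.
    by rewrite -(mem_imset _ _ f_inj) (subsetP MF) // imset_f.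
  by rewrite dimf (pD M maxM); lia.
subst m.
have fK (G : {set U}) : G \in S -> f @: (f @^-1: G) = G.
  move=> GS; apply/eqP; rewrite eqEsubset; apply/andP; split.
    by apply/subsetP => _ /imsetP[u + ->]; rewrite inE.
  apply/subsetP => u uG; have uS : [set u] \in S.
    by apply: clS GS _; rewrite sub1set.
  have : [set u] \in boundary_complex k S.
    by apply: contraT => uB; case: (iS [set u]) => //;
      rewrite /face_dim cards1; lia.
  rewrite bS => /imsetP[F _ uF]; have : u \in f @: F by rewrite -uF set11.
  by move=> /imsetP[w _ uw]; rewrite uw imset_f // inE -uw.
pose S' := [set F : {set T} | f @: F \in S].
have eS : S = relabel f S'.
  apply/setP => G; apply/idP/imsetP => [GS|[F + ->]]; last by rewrite inE.
  by exists (f @^-1: G); rewrite ?inE fK.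
have bettiS' F i : betti k (link S' F) i = betti k (link S (f @: F)) i.
  by rewrite eS link_relabel // betti_relabel.
have boundaryS' F : (F \in boundary_complex k S') = (f @:
  F \in boundary_complex k S).
  rewrite !inE imset_eq0; congr (_ && _ || _).
  by apply/asboolP/asboolP => b0 i; have := b0 i; rewrite bettiS'.
have bS' : boundary_complex k S' = D.
  by apply/setP => F; rewrite boundaryS' bS mem_imset.
exists S' => //; split; last first.
  move=> F [FS' nFB]; rewrite -dimf; apply: iS.
  by split; [move: FS'; rewrite inE | rewrite -boundaryS'].
split=> //.
- split=> [|F G]; rewrite !inE ?imset0 // => FS GF.
  by apply: clS FS _; apply: imsetS.
- move=> M /maxsetP[MS' maxM]; rewrite -dimf; apply: pS; apply/maxsetP.
  split=> [|G]; first by move: MS'; rewrite inE.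
  rewrite {1}eS => /imsetP[F FS' ->] MF; rewrite (maxM F) //.
  apply/subsetP => u uM.
  by rewrite -(mem_imset _ _ f_inj) (subsetP MF) // imset_f.
- move=> F; rewrite inE bettiS' -(imset_eq0 f) => FS F0.
  have := lS _ FS F0; rewrite card_imset // => -[b0 b1]; split=> // i ei.
  by rewrite bettiS' b0.
- by rewrite bS'.
Qed.

(** * The filling determined by the small faces of the manifold *)

Section LocalToGlobal.

Variables (k : fieldType) (T : finType) (n s : int) (Delta : {set {set T}}).
Implicit Types (F G H : {set T}) (v : T) (i : int).
Hypotheses (s_ge0 : 0 <= s) (le_s_n : 2 * (s + 1) <= n).
Hypothesis Delta_manifold : homology_manifold k n Delta.
Hypothesis Delta_stacked : locally_stacked k s Delta.

(** The complex X, with [s = r - 1]. The bound exceeds by one the Leray bound [s] of the fillings of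
    links, because a face of a link gains a vertex. *)
Definition flag_filling : {set {set T}} :=
  [set F : {set T} | [forall G : {set T},
    (G \subset F) && (face_dim G <= s + 1) ==> (G \in Delta)]].

Lemma flag_fillingP F :
  reflect (forall G, G \subset F -> face_dim G <= s + 1 -> G \in Delta)
          (F \in flag_filling).
Proof.
rewrite inE; apply: (iffP forallP) => [sF G GF dG | sF G].
  by have := sF G; rewrite GF dG.
by apply/implyP => /andP[]; apply: sF.
Qed.

Lemma sub_flag_filling F : F \in Delta -> F \in flag_filling.
Proof.
by have [[_ clD] _ _] := Delta_manifold => FD;
  apply/flag_fillingP => G /(clD _ _ FD).
Qed.

Lemma flag_filling_complex : simplicial_complex flag_filling.
Proof.
split=> [|F G /flag_fillingP sF GF].
  by apply: sub_flag_filling; have [[]] := Delta_manifold.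
apply/flag_fillingP => H HG; apply: sF; exact: subset_trans HG GF.
Qed.

Lemma vertex_flag_filling F v : F \in flag_filling -> v \in F ->
  [set v] \in Delta.
Proof.
move=> /flag_fillingP sF vF; apply: sF; rewrite ?sub1set //.
by rewrite /face_dim cards1; lia.
Qed.

Lemma link_flag_filling v : [set v] \in Delta ->
  [/\ stacked_with_boundary k n s (link flag_filling [set v]),
      boundary_complex k (link flag_filling [set v]) = link Delta [set v] &
      forall i, betti k (link flag_filling [set v]) i = 0%N].
Proof.
move=> vD; have [cD pD /(_ v vD) sL] := Delta_manifold.
have cX := flag_filling_complex.
have [||S stS bS] := @stacked_on_vertices k T n s (link Delta [set v]) _ _
  (Delta_stacked vD); [exact: homology_sphere_manifold | lia |].
have sB : homology_sphere k (n - 1) (boundary_complex k S) by rewrite bS.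
have [[cS _ _ _] _] := stS; have [S0 clS] := cS.
suff -> : link flag_filling [set v] = S.
  by split=> // i; apply: (stacked_acyclic s_ge0 le_s_n stS sB).
(* Since [s + 1 <= n - s - 1], these faces lie on the boundary of [S], which is the link of [v] in
   [Delta]. *)
have smallS F : F \in S -> face_dim F <= s + 1 ->
  (v |: F \in Delta) && (v \notin F).
  move=> FS dF; rewrite -in_link1 // -bS; apply: (stacked_small_face stS FS).
  by move: dF; lia.
apply/setP => G; rewrite in_link1 //; apply/andP/idP => [[vGX vG]|GS].
  (* For [H] of dimension at most [s], the set [v |: H] is still small enough to be a face of
     [Delta]. *)
  apply: (leray_flag cS (stacked_leray s_ge0 le_s_n stS sB)) => H HG dH.
  have vH : v \notin H by apply: contra vG; apply: subsetP.
  apply: (@boundary_sub k); rewrite // bS in_link1 // vH andbT.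
  apply: (flag_fillingP _ vGX); first by rewrite setUS.
  by move: dH; rewrite /face_dim cardsU1 vH; lia.
(* Vertices of [S] are vertices of the link of [v], and [v] is not one. *)
have vG : v \notin G.
  apply/negP => vG.
  have /andP[_] : (v |: [set v] \in Delta) && (v \notin [set v]).
    apply: smallS; first by apply: clS GS _; rewrite sub1set.
    by rewrite /face_dim cards1; lia.
  by rewrite set11.
split=> //; apply/flag_fillingP => H HvG dH.
have HvS : H :\ v \in S by apply: clS GS _; rewrite subDset.
have /smallS/andP[] : face_dim (H :\ v) <= s + 1.
  have [vH|vH] := boolP (v \in H); first by rewrite face_dimD1 //; lia.
  rewrite (_ : H :\ v = H) //; apply/setDidPl.
  by rewrite disjoint_sym disjoints1.
- exact: HvS.
move=> vHD _; case: cD => _; apply; first exact: vHD.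
by rewrite -subDset.
Qed.

(** For [v] in [F], the link of [F] in X is the link of [F :\ v] in lk_X(v), whose boundary is the
    link of [v] in [Delta]. *)
Lemma boundary_flag_filling : boundary_complex k flag_filling = Delta.
Proof.
have [cD _ _] := Delta_manifold; have cX := flag_filling_complex.
apply/setP => F; have [->|F0] := eqVneq F set0.
  by rewrite set0_boundary; case: cD.
have [v vF] := set0Pn _ F0.
have [vD|vD] := boolP ([set v] \in Delta); last first.
  have nF : F \notin flag_filling by apply: contra vD => /vertex_flag_filling;
    apply.
  transitivity false; last by apply/esym/negP => /sub_flag_filling; apply/negP.
  by apply/negP => /(in_boundary _ _ F0)[FX _]; rewrite FX in nF.
have [_ bL aL] := link_flag_filling vD; have vX := sub_flag_filling vD.
have F1L : (F :\ v \in link Delta [set v]) = (F \in Delta).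
  by rewrite in_link1 // setD1K // setD11 andbT.
have F1X : (F :\ v \in link flag_filling [set v]) = (F \in flag_filling).
  by rewrite in_link1 // setD1K // setD11 andbT.
have lX : F \in flag_filling ->
    link flag_filling F = link (link flag_filling [set v]) (F :\ v).
  by move=> FX; rewrite link_link ?F1X // setD1K.
(* The empty face is on every boundary by convention, so for [F = [set v]] the acyclicity of lk_X(v)
   has to be used instead. *)
rewrite -F1L -bL; have [F10|F10] := eqVneq (F :\ v) set0.
  have Ev : F = [set v] by rewrite -(setD1K vF) F10 setU0.
  rewrite F10 set0_boundary; apply/(in_boundary _ _ F0).
  by rewrite Ev; split.
apply/idP/idP => /(in_boundary _ _).
  move=> /(_ F0)[FX bF]; apply/(in_boundary _ _ F10).
  by rewrite F1X; split=> // i; rewrite -lX.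
move=> /(_ F10)[]; rewrite F1X => FX bF; apply/(in_boundary _ _ F0).
by split=> // i; rewrite lX.
Qed.

(** Each condition on a nonempty face passes to the link of one of its vertices, where the face
    loses one dimension and [n + 1] becomes [n]. *)
Lemma flag_filling_stacked : stacked_with_boundary k (n + 1) s flag_filling.
Proof.
have cX := flag_filling_complex; have [[D0 clD] pD _] := Delta_manifold.
(* This vertex keeps the empty face from being a facet of X. *)
have [v0 v0D] : exists v, [set v] \in Delta.
  have [M maxM _] := maxset_above D0; have dM := pD M maxM.
  have [MD _] := maxsetP maxM.
  have [v vM] : exists v, v \in M.
    by apply/card_gt0P; move: dM; rewrite /face_dim; lia.
  by exists v; apply: clD MD _; rewrite sub1set.
have D1_link F v : F \in flag_filling -> v \in F ->
    F :\ v \in link flag_filling [set v].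
  by move=> FX vF; rewrite in_link1 // setD1K // setD11 FX.
split; last first.
  move=> F [FX]; rewrite boundary_flag_filling => FD.
  have [F0|[v vF]] := set_0Vmem F; first by rewrite F0 D0 in FD.
  have vD := vertex_flag_filling FX vF.
  have [[_ iL] bL _] := link_flag_filling vD.
  have /iL : interior_face k (link flag_filling [set v]) (F :\ v).
    split; first exact: D1_link.
    by rewrite bL in_link1 // setD1K // negb_and FD.
  by rewrite face_dimD1 //; lia.
split=> //; last by rewrite boundary_flag_filling addrK.
- move=> F /maxsetP[FX maxF].
  have [F0|[v vF]] := set_0Vmem F.
    have v0F : [set v0] = F.
      by apply: maxF; [exact: sub_flag_filling | rewrite F0 sub0set].
    by have := set11 v0; rewrite v0F F0 inE.
  have [[[_ pL _ _] _] _ _] := link_flag_filling (vertex_flag_filling FX vF).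
  suff /pL : maxset (fun G => G \in link flag_filling [set v]) (F :\ v).
    by rewrite face_dimD1 //; lia.
  apply/maxsetP; split=> [|G]; first exact: D1_link.
  rewrite in_link1 // => /andP[vGX vG] FG; rewrite -(setU1K vG) (maxF _ vGX) //.
  by rewrite -subDset.
move=> F FX F0; have [v vF] := set0Pn _ F0.
have vD := vertex_flag_filling FX vF.
have [[[_ _ lL _] _] _ aL] := link_flag_filling vD.
have F1X := D1_link _ _ FX vF.
have <- : link (link flag_filling [set v]) (F :\ v) = link flag_filling F.
  by rewrite link_link ?setD1K // sub_flag_filling.
(* [lL] covers nonempty faces of the link only; for [F = [set v]] acyclicity makes every Betti
   number 0. *)
have [F10|F10] := eqVneq (F :\ v) set0.
  by rewrite F10 link0; split=> [i _|]; rewrite aL.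
have := lL _ F1X F10.
rewrite (_ : n + 1 - #|F|%:Z = n - #|F :\ v|%:Z) //.
by rewrite (cardsD1 v F) vF; lia.
Qed.

End LocalToGlobal.

(** * Restricting a filling to vertex links, and gluing fillings of vertex links *)

Theorem theorem4p6 (k : fieldType) (k_infinite : infinite_field k)
    (d r : int) (r_ge1 : 1 <= r) (r_lt : r%:Q < d%:Q / 2)
    (T : finType) (Delta : {set {set T}})
    (Delta_manifold : homology_manifold k (d - 1) Delta) :
  stacked k (r - 1) Delta <-> locally_stacked k (r - 1) Delta.
Proof.
have [cD _ _] := Delta_manifold; split=> [|locD].
  move=> [U [f [m [S [f_inj stS bS]]]]] v vD; exists U, f, (m - 1).
  have [[cS _ _ [cB _ _]] _] := stS.
  have vB : [set f v] \in boundary_complex k S.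
    by rewrite bS -imset_set1 imset_f.
  (* The link of [f v] in a filling of [Delta] fills the image of the link of [v]. *)
  exists (link S [set f v]); split=> //;
    first exact: stacked_with_boundary_link.
  by rewrite boundary_link // bS -imset_set1 -/(relabel f Delta) link_relabel.
(* Over the integers this is [2 * (s + 1) <= n] for [s = r - 1] and [n = d - 1]. *)
have lt_2r_d : 2 * r < d.
  move: r_lt; rewrite ltr_pdivlMr // mulrC.
  by rewrite -(ltr_int rat) intrM.
exists T, id, d, (flag_filling (r - 1) Delta); split=> //.
  rewrite -{1}(subrK 1 d); apply: flag_filling_stacked => //; lia.
rewrite (boundary_flag_filling _ _ Delta_manifold) //; try lia.
by apply/setP => F; apply/idP/imsetP => [FD|[G GD ->]]; rewrite ?imset_id //;
  exists F; rewrite // imset_id.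
Qed.
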